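(* Let $1\le p<\infty$, let $\omega=(\omega_k)_{k\in\mathbb N}$ be a sequence of positive real numbers with $\sup_{k\in\mathbb N}\omega_k/\omega_{k+1}<\infty$, and let $B$ be the backward shift operator on $\ell^p(\mathbb N,\omega)$. Assume that $\omega$ is equivalent to a nonincreasing weight. Then the following assertions are equivalent: (1) $B$ is $p$-absolutely Cesàro bounded. (2) $B$ is Cesàro bounded.
   Context: $\mathbb N=\{1,2,\dots\}$ and $\mathbb K$ is $\mathbb R$ or $\mathbb C$. A weight is a sequence of positive real numbers. $\ell^p(\mathbb N,\omega)=\{(x_k)\in\mathbb K^{\mathbb N}:\sum_{k\ge1}|x_k|^p\omega_k^p<\infty\}$ with norm $\|x\|_{p,\omega}=(\sum_{k\ge1}|x_k|^p\omega_k^p)^{1/p}$, and $B((x_k)_{k})=(x_{k+1})_{k}$. Two weights $\omega,\omega'$ are equivalent if there are $0<a\le b<\infty$ with $a\omega_n\le\omega'_n\le b\omega_n$ for all $n\in\mathbb N$. A bounded operator $T$ on a Banach space $X$ is $p$-absolutely Cesàro bounded if there is $C>0$ with $\sup_{n\ge1}\frac1n\sum_{k=0}^{n-1}\|T^kx\|^p\le C\|x\|^p$ for all $x\in X$; it is Cesàro bounded if $\sup_{n\ge1}\big\|\frac1n\sum_{k=0}^{n-1}T^k\big\|<\infty$. *)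

(* Defs.v *)
From HB Require Import structures.
From mathcomp Require Import all_boot all_order all_algebra.
From mathcomp Require Import all_classical all_reals all_analysis.
From mathcomp Require Import complex.

Set Implicit Arguments.
Unset Strict Implicit.
Unset Printing Implicit Defensive.

Import Order.TTheory GRing.Theory Num.Theory.
Import numFieldNormedType.Exports.
Local Open Scope classical_set_scope.
Local Open Scope ring_scope.

(* The scalar field is R or C = R[i].  In both cases MathComp norms take values
   in the scalar field itself; [re] brings them back to R. *)
Variant scalars := RealScalars | ComplexScalars.

Definition scalar_field (R : realType) (s : scalars) : numFieldType :=
  match s with RealScalars => R | ComplexScalars => R[i] end.

Definition of_real (R : realType) (s : scalars) : R -> scalar_field R s :=
  match s with RealScalars => id | ComplexScalars => real_complex R end.

Definition re (R : realType) (s : scalars) : scalar_field R s -> R :=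
  match s with RealScalars => id | ComplexScalars => @complex.Re R end.

Definition rnorm (R : realType) (s : scalars)
    (X : normedZmodType (scalar_field R s)) (x : X) : R := re `|x|.

Section scalar_field_theory.
Variables (R : realType) (s : scalars).
Local Notation K := (scalar_field R s).

Lemma of_realK : cancel (@of_real R s) (@re R s).
Proof. by case: s. Qed.

Lemma of_realD (x y : R) : of_real s (x + y) = of_real s x + of_real s y.
Proof. by case: s => //=; rewrite rmorphD. Qed.

Lemma of_realM (x y : R) : of_real s (x * y) = of_real s x * of_real s y.
Proof. by case: s => //=; rewrite rmorphM. Qed.

Lemma ler_of_real (x y : R) : (of_real s x <= of_real s y) = (x <= y).
Proof. by case: s => //=; rewrite lecR. Qed.

Lemma of_real0 : of_real s 0 = 0 :> K.
Proof. by case: s. Qed.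

Lemma reK_ge0 (z : K) : 0 <= z -> of_real s (re z) = z.
Proof. by case: s z => //= z /ger0_real /RRe_real. Qed.

Lemma of_real_rnorm (X : normedZmodType K) (x : X) : of_real s (rnorm x) = `|x|.
Proof. exact/reK_ge0/normr_ge0. Qed.

Lemma rnorm_ge0 (X : normedZmodType K) (x : X) : 0 <= rnorm x.
Proof. by rewrite -ler_of_real of_real_rnorm of_real0. Qed.

Lemma ler_rnormD (X : normedZmodType K) (x y : X) :
  rnorm (x + y) <= rnorm x + rnorm y.
Proof. by rewrite -ler_of_real of_realD !of_real_rnorm ler_normD. Qed.

Lemma rnorm0_eq0 (X : normedZmodType K) (x : X) : rnorm x = 0 -> x = 0.
Proof.
by move=> x0; apply/normr0_eq0; rewrite -of_real_rnorm x0 of_real0.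
Qed.

Lemma rnorm0 (X : normedZmodType K) : rnorm (0 : X) = 0.
Proof. by rewrite /rnorm normr0 -of_real0 of_realK. Qed.

Lemma rnormM (x y : K) : rnorm (x * y) = rnorm x * rnorm y.
Proof.
by apply: (can_inj of_realK); rewrite of_realM !of_real_rnorm normrM.
Qed.

End scalar_field_theory.

(* Index k stands for k + 1 in N = {1, 2, ...}. *)
Record weight (R : realType) := Weight {
  weight_fun :> nat -> R ;
  weight_gt0 : forall k, 0 < weight_fun k }.

Definition equivalent_weights (R : realType) (w w' : weight R) :=
  exists a b : R, [/\ 0 < a, a <= b & forall n, a * w n <= w' n <= b * w n].

(* [lp_sum] and [lp_norm] are locked only to keep unification from unfolding
   infinite sums and real powers. *)
HB.lock Definition lp_sum (R : realType) (s : scalars) (p : R) (w : weight R)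
    (x : nat -> scalar_field R s) : \bar R :=
  (\sum_(0 <= k <oo) ((rnorm (x k)) `^ p * (w k) `^ p)%:E)%E.
Canonical lp_sum_unlockable := Unlockable lp_sum.unlock.
Arguments lp_sum {R s} p w x.

HB.lock Definition lp_norm (R : realType) (s : scalars) (p : R) (w : weight R)
    (x : nat -> scalar_field R s) : R :=
  fine (lp_sum p w x) `^ p^-1.
Canonical lp_norm_unlockable := Unlockable lp_norm.unlock.
Arguments lp_norm {R s} p w x.

Section weighted_lp.
Variables (R : realType) (s : scalars).
Local Notation K := (scalar_field R s).

(* The unused argument [1 <= p] makes [p] and its bound part of the type [lp]
   below, as the norm structure on [lp] requires this bound. *)
Definition lp_pred (p : R) (hp : 1 <= p) (w : weight R) : {pred nat -> K} :=
  [pred x | `[< (lp_sum p w x < +oo)%E >]].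

Record lp (p : R) (hp : 1 <= p) (w : weight R) := Lp {
  lp_fun :> nat -> K ;
  lp_funP : lp_fun \in lp_pred hp w }.

Lemma lp_sum_ge0 p w (x : nat -> K) : (0 <= lp_sum p w x)%E.
Proof.
rewrite lp_sum.unlock; apply: nneseries_ge0 => k _ _.
by rewrite lee_fin mulr_ge0// powR_ge0.
Qed.

Lemma lp_sum_Lnorm (p : R) (w : weight R) (x : nat -> K) : 1 <= p ->
  (lp_sum p w x `^ p^-1)%E =
  Lnorm counting p%:E (EFin \o (fun k => rnorm (x k) * w k)).
Proof.
move=> p1; rewrite Lnorm_counting ?(lt_le_trans ltr01)//.
rewrite lp_sum.unlock; congr (_ `^ _)%E; apply: eq_eseriesr => k _ /=.
have w0 := ltW (weight_gt0 w k).
by rewrite ger0_norm ?powRM ?mulr_ge0 ?rnorm_ge0.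
Qed.

Lemma lp_sumD (p : R) (w : weight R) (x y : nat -> K) : 1 <= p ->
  (lp_sum p w (x + y)%R `^ p^-1 <=
   lp_sum p w x `^ p^-1 + lp_sum p w y `^ p^-1)%E.
Proof.
move=> p1; have p0 : 0 < p by exact: lt_le_trans ltr01 p1.
have mf (f : nat -> R) : measurable_fun [set: nat] f by [].
have := minkowski_EFin counting (mf (fun k => rnorm (x k) * w k))
  (mf (fun k => rnorm (y k) * w k)) p1.
rewrite -!lp_sum_Lnorm//; apply: le_trans.
rewrite Lnorm_counting//; apply: gt0_ler_poweR.
- by rewrite invr_ge0 ltW.
- by rewrite in_itv/= leey andbT lp_sum_ge0.
- by rewrite in_itv/= leey andbT nneseries_ge0.
rewrite lp_sum.unlock; apply: lee_nneseries => k _ /=; first by rewrite lee_fin mulr_ge0 ?powR_ge0.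
have w0 := ltW (weight_gt0 w k).
rewrite -powRM ?rnorm_ge0//.
rewrite -mulrDl ger0_norm ?mulr_ge0 ?addr_ge0 ?rnorm_ge0//.
rewrite lee_fin; apply: ge0_ler_powR; rewrite ?nnegrE ?mulr_ge0 ?addr_ge0 ?rnorm_ge0 ?(ltW p0)//.
by rewrite ler_wpM2r// ler_rnormD.
Qed.

Lemma lp_sumZ (p : R) (w : weight R) (a : K) (x : nat -> K) :
  lp_sum p w (a *: x) = ((rnorm a `^ p)%:E * lp_sum p w x)%E.
Proof.
rewrite lp_sum.unlock -nneseriesZl//; last first.
  by move=> k _; rewrite lee_fin mulr_ge0// powR_ge0.
apply: eq_eseriesr => k _.
by rewrite [(a *: x) k]/(a * x k) rnormM powRM ?rnorm_ge0// -EFinM mulrA.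
Qed.

Section lp_theory.
Variables (p : R) (hp : 1 <= p) (w : weight R).

HB.instance Definition _ := [isSub for @lp_fun p hp w].
HB.instance Definition _ := [Choice of lp hp w by <:].

Lemma lp_submod_closed : submod_closed (lp_pred hp w).
Proof.
have p0 : 0 < p by exact: lt_le_trans ltr01 hp.
split.
  apply/asboolP; rewrite lp_sum.unlock eseries0// => k _ _.
  by rewrite rnorm0 powR0 ?gt_eqF// mul0r.
move=> a x y /asboolP fx /asboolP fy; apply/asboolP.
apply: (@lty_poweRy _ _ p^-1); first by rewrite invr_eq0 gt_eqF.
apply: (le_lt_trans (lp_sumD _ _ _ hp)).
apply: lte_add_pinfty; apply: poweR_lty; last exact: fy.
rewrite lp_sumZ; apply: lte_mul_pinfty => //; exact: powR_ge0.
Qed.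

HB.instance Definition _ :=
  GRing.isSubmodClosed.Build K (nat -> K) (lp_pred hp w) lp_submod_closed.
HB.instance Definition _ := [SubChoice_isSubLmodule of lp hp w by <:].

Lemma lp_funD (x y : lp hp w) : lp_fun (x + y) = lp_fun x + lp_fun y.
Proof. by []. Qed.

Lemma lp_funZ (a : K) (x : lp hp w) : lp_fun (a *: x) = a *: lp_fun x.
Proof. by []. Qed.

Lemma lp_sum_fin (x : lp hp w) : lp_sum p w x \is a fin_num.
Proof.
by rewrite ge0_fin_numE ?lp_sum_ge0//; have /asboolP := lp_funP x.
Qed.

Lemma lp_normE (x : lp hp w) : (lp_norm p w x)%:E = (lp_sum p w x `^ p^-1)%E.
Proof.
by rewrite lp_norm.unlock -[in RHS](fineK (lp_sum_fin x)) poweR_EFin.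
Qed.

Let lp_normK (x : lp hp w) : K := of_real s (lp_norm p w x).

Let lp_normKD x y : lp_normK (x + y) <= lp_normK x + lp_normK y.
Proof.
have := lp_sumD w x y hp.
rewrite -lp_funD -(lp_normE (x + y)) -(lp_normE x) -(lp_normE y).
by rewrite -EFinD lee_fin -(ler_of_real s) of_realD.
Qed.

Let lp_normKZ (a : K) x : lp_normK (a *: x) = `|a| * lp_normK x.
Proof.
rewrite /lp_normK -of_real_rnorm -of_realM; congr of_real.
apply: EFin_inj; rewrite lp_normE lp_funZ lp_sumZ.
rewrite poweRM ?lee_fin ?powR_ge0 ?lp_sum_ge0// EFinM lp_normE.
rewrite poweR_EFin -powRrM mulfV ?powRr1 ?rnorm_ge0//.
by rewrite gt_eqF// (lt_le_trans ltr01).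
Qed.

Let lp_normK0 x : lp_normK x = 0 -> x = 0.
Proof.
have p0 : 0 < p by exact: lt_le_trans ltr01 hp.
rewrite -(of_real0 R s) => /(can_inj (@of_realK R s)) x0.
apply/val_inj/funext => k /=; apply: rnorm0_eq0.
have /eqP := x0; rewrite lp_norm.unlock powR_eq0 => /andP[/eqP s0 _].
have {}s0 : lp_sum p w x = 0%E by rewrite -(fineK (lp_sum_fin x)) s0.
have := s0; rewrite lp_sum.unlock => /eqP; rewrite eq_le => /andP[+ _].
rewrite (@nneseriesD1 _ _ k)//; last first.
  by move=> n _; rewrite lee_fin mulr_ge0// powR_ge0.
move=> h; have : ((rnorm (x k) `^ p * w k `^ p)%:E <= 0)%E.
  apply: le_trans h; rewrite leeDl// nneseries_ge0// => n _ _.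
  by rewrite lee_fin mulr_ge0// powR_ge0.
rewrite lee_fin pmulr_lle0 ?powR_gt0 ?weight_gt0// => h'.
have /eqP : rnorm (x k) `^ p == 0 by rewrite eq_le h' powR_ge0.
by move=> /powR_eq0_eq0.
Qed.

HB.instance Definition _ :=
  Lmodule_isNormed.Build K (lp hp w) lp_normKD lp_normKZ lp_normK0.

Lemma rnorm_lpE (x : lp hp w) : rnorm x = lp_norm p w x.
Proof. exact: of_realK. Qed.

End lp_theory.
End weighted_lp.

Section bounded_operators.
Variables (R : realType) (s : scalars).
Local Notation K := (scalar_field R s).

Record bounded_operator (X : normedModType K) := BoundedOperator {
  operator_fun :> {linear X -> X} ;
  operator_bounded : bounded_near operator_fun (nbhs (0 : X)) }.

Definition opnorm (X : normedModType K) (T : X -> X) : \bar R :=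
  ereal_sup [set (rnorm (T x))%:E | x in [set x : X | rnorm x <= 1]].

Definition cesaro_mean (X : normedModType K) (T : X -> X) (n : nat) (x : X) : X :=
  (n%:R^-1 : K) *: \sum_(k < n) iter k T x.

Definition p_absolutely_cesaro_bounded (p : R) (X : normedModType K)
    (T : bounded_operator X) :=
  exists2 C : R, 0 < C & forall x : X,
    (ereal_sup [set (n%:R^-1 * \sum_(k < n) (rnorm (iter k T x)) `^ p)%:E
               | n in [set n | (0 < n)%N]] <= (C * (rnorm x) `^ p)%:E)%E.

Definition cesaro_bounded (X : normedModType K) (T : bounded_operator X) :=
  (ereal_sup [set opnorm (cesaro_mean T n) | n in [set n | (0 < n)%N]] < +oo)%E.

End bounded_operators.

Section backward_shift.
Variables (R : realType) (s : scalars) (p : R) (hp : 1 <= p) (w : weight R).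
Local Notation K := (scalar_field R s).
Variable hw : has_ubound (range (fun k => w k / w k.+1)).

Definition shift_seq (x : nat -> K) : nat -> K := fun k => x k.+1.

Lemma lp_sum_shift : exists2 M : R, 0 <= M &
  forall x : nat -> K, (lp_sum p w (shift_seq x) <= (M `^ p)%:E * lp_sum p w x)%E.
Proof.
have p0 : 0 < p by exact: lt_le_trans ltr01 hp.
have [M hM] := hw.
have wM k : w k <= M * w k.+1.
  by rewrite -ler_pdivrMr ?weight_gt0//; apply: hM; exists k.
have M0 : 0 <= M.
  by rewrite (le_trans _ (hM (w 0%N / w 1%N) _)) ?divr_ge0 ?ltW ?weight_gt0.
have t0 (x : nat -> K) k : (0 <= (rnorm (x k) `^ p * w k `^ p)%:E)%E.
  by rewrite lee_fin mulr_ge0 ?powR_ge0.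
have t1 (x : nat -> K) k :
    (0 <= (M `^ p)%:E * (rnorm (x k) `^ p * w k `^ p)%:E)%E.
  by rewrite mule_ge0 ?lee_fin ?powR_ge0// mulr_ge0 ?powR_ge0.
exists M => // x; rewrite lp_sum.unlock -nneseriesZl//.
rewrite [leRHS]nneseries_recl//=.
apply: (@le_trans _ _ (\sum_(1 <= k <oo)
    ((M `^ p)%:E * (rnorm (x k) `^ p * w k `^ p)%:E))%E); last first.
  by rewrite leeDr//; exact: t1.
rewrite -(@nneseries_addn _ (fun k => (M `^ p)%:E *
  (rnorm (x k) `^ p * w k `^ p)%:E)%E 1)//.
apply: lee_nneseries => [k _ _|k _]; first exact: t0.
rewrite addn1 -EFinM lee_fin mulrCA ler_wpM2l ?powR_ge0//.
rewrite -powRM ?(ltW (weight_gt0 w _))//.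
by apply: ge0_ler_powR;
  rewrite ?nnegrE ?mulr_ge0 ?(ltW (weight_gt0 w _)) ?(ltW p0).
Qed.

Lemma shift_seq_lp (x : lp s hp w) : shift_seq x \in lp_pred hp w.
Proof.
have [M M0 hM] := lp_sum_shift.
apply/asboolP; apply: (le_lt_trans (hM x)).
apply: lte_mul_pinfty; first exact: powR_ge0.
  by [].
exact/asboolP/lp_funP.
Qed.

Definition lp_shift (x : lp s hp w) : lp s hp w := Lp (shift_seq_lp x).

Lemma lp_shift_linear : linear lp_shift.
Proof. by move=> a x y; apply/val_inj. Qed.

HB.instance Definition _ :=
  GRing.isLinear.Build K (lp s hp w) (lp s hp w) _ lp_shift lp_shift_linear.

Lemma lp_shift_bounded : bounded_near lp_shift (nbhs (0 : lp s hp w)).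
Proof.
have p0 : 0 < p by exact: lt_le_trans ltr01 hp.
have [M M0 hM] := lp_sum_shift.
have shiftM x : `|lp_shift x| <= of_real s M * `|x|.
  rewrite -!of_real_rnorm -of_realM ler_of_real !rnorm_lpE.
  rewrite -lee_fin EFinM 2!lp_normE.
  have -> : M%:E = ((M `^ p)%:E `^ p^-1)%E.
    by rewrite poweR_EFin -powRrM mulfV ?powRr1// gt_eqF.
  rewrite -poweRM ?lee_fin ?powR_ge0 ?lp_sum_ge0//.
  apply: gt0_ler_poweR; last exact: hM.
  - by rewrite invr_ge0 ltW.
  - by rewrite in_itv/= leey andbT lp_sum_ge0.
  - by rewrite in_itv/= leey andbT mule_ge0 ?lee_fin ?powR_ge0 ?lp_sum_ge0.
apply/linear_boundedP; near=> r => x.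
apply: le_trans (shiftM x) _; apply: ler_wpM2r; first exact: normr_ge0.
near: r; apply: nbhs_pinfty_ge; apply: ger0_real.
by rewrite -(of_real0 R s) ler_of_real.
Unshelve. all: by end_near. Qed.

Definition backward_shift : bounded_operator (lp s hp w) :=
  BoundedOperator lp_shift_bounded.

End backward_shift.

(* Main.v *)
(* (1) => (2) follows from [t <= 1 + t^p].  Exchanging the order of summation,
   (1) amounts to the window estimate
     [\sum_(k < n, k <= m) w_(m-k)^p <= C n w_m^p].
   For (2) => (1), test the mean of order [2n] on the indicator [x] of
   [m, m + 2n).  The coordinates of this mean in (m - n, m] are at least 1/2, so
   its norm dominates the window sum, while [|x|^p = O(n w_m^p)] because [w] is
   nonincreasing up to a constant. *)

Require Import Defs.
From HB Require Import structures.
From mathcomp Require Import all_boot all_order all_algebra.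
From mathcomp Require Import all_classical all_reals all_analysis.
From mathcomp Require Import complex.
From mathcomp Require Import ring.

Import Order.TTheory GRing.Theory Num.Theory.
Import numFieldNormedType.Exports.
Local Open Scope classical_set_scope.
Local Open Scope ring_scope.

(** * Norm estimates valid for every bounded operator *)

Lemma rnorm_natf_div (R : realType) (s : scalars) (n c : nat) :
  rnorm ((n%:R^-1 * c%:R : scalar_field R s) : scalar_field R s) = n%:R^-1 * c%:R.
Proof.
apply: (can_inj (@of_realK R s)); rewrite of_real_rnorm.
rewrite ger0_norm ?mulr_ge0 ?invr_ge0//.
by case: s => //=; rewrite rmorphM fmorphV !rmorph_nat.
Qed.

Lemma rnormZ (R : realType) (s : scalars) (X : normedModType (scalar_field R s))
    (a : scalar_field R s) (x : X) : rnorm (a *: x) = rnorm a * rnorm x.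
Proof.
apply: (can_inj (@of_realK R s)).
by rewrite of_realM !of_real_rnorm normrZ.
Qed.

Lemma ler_rnorm_sum (R : realType) (s : scalars)
    (X : normedModType (scalar_field R s)) (n : nat) (F : 'I_n -> X) :
  rnorm (\sum_(k < n) F k) <= \sum_(k < n) rnorm (F k).
Proof.
elim/big_ind2 : _ => [|x a y b xa yb|//]; first by rewrite rnorm0.
exact: le_trans (ler_rnormD _ _) (lerD xa yb).
Qed.

Lemma ler_powRD1 (R : realType) (p t : R) : 1 <= p -> t <= 1 + t `^ p.
Proof.
move=> p1; have [t1|t1] := leP t 1.
  by rewrite (le_trans t1)// lerDl powR_ge0.
by rewrite (le_trans (le1r_powR (ltW t1) p1))// lerDr.
Qed.

(** On the unit ball the triangle inequality bounds the mean by the average of the norms of the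
    [iter k T x]. Each such norm [t] is at most 1 + t^p, and the average of the t^p is at most [C],
    whence the bound [1 + C]. *)
Lemma p_absolutely_cesaro_boundedW (R : realType) (s : scalars)
    (p : R) (X : normedModType (scalar_field R s)) (T : bounded_operator X) :
  1 <= p -> p_absolutely_cesaro_bounded p T -> cesaro_bounded T.
Proof.
move=> p1 [C C0 hC]; apply: (@le_lt_trans _ _ (1 + C)%:E); last exact: ltry.
apply: ge_ereal_sup => _ [n n0 <-]; apply: ge_ereal_sup => _ [x x1 <-].
have p0 : 0 <= p by exact: le_trans ler01 p1.
have {}hC : n%:R^-1 * \sum_(k < n) (rnorm (iter k T x)) `^ p <= C.
  have supC := hC x; rewrite -lee_fin.
  apply: le_trans (le_trans (ereal_sup_ubound (imageP _ n0)) supC) _.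
  rewrite lee_fin ler_piMr ?(ltW C0)//.
  have := ge0_ler_powR p0 (rnorm_ge0 x) ler01 x1.
  by rewrite powR1.
have nV0 : 0 <= n%:R^-1 :> R by rewrite invr_ge0.
have rV : rnorm (n%:R^-1 : scalar_field R s) = n%:R^-1.
  by rewrite -[X in rnorm X]mulr1 (rnorm_natf_div R s n 1) mulr1.
rewrite lee_fin /cesaro_mean rnormZ rV.
apply: le_trans (ler_wpM2l nV0 (ler_rnorm_sum _ _ _ _ _)) _.
apply: (@le_trans _ _ (n%:R^-1 * \sum_(k < n) (1 + rnorm (iter k T x) `^ p))).
  by rewrite ler_wpM2l// ler_sum// => k _; exact: ler_powRD1.
rewrite big_split/= sumr_const card_ord mulrDr mulVf ?lerD2l//.
by rewrite pnatr_eq0 -lt0n.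
Qed.

(** Homogeneity of the means carries the bound from the unit ball to all vectors, with a real
    constant in place of an extended real supremum. *)
Lemma cesaro_bounded_rnorm (R : realType) (s : scalars)
    (X : normedModType (scalar_field R s)) (T : bounded_operator X) :
  cesaro_bounded T ->
  exists2 C : R, 0 < C & forall n x, (0 < n)%N ->
    rnorm (cesaro_mean T n x) <= C * rnorm x.
Proof.
move=> hT; have op_bound n x : (0 < n)%N -> rnorm x <= 1 ->
    ((rnorm (cesaro_mean T n x))%:E <=
     ereal_sup [set opnorm (cesaro_mean T n) | n in [set n | (0 < n)%N]])%E.
  move=> n0 x1; apply: (@le_trans _ _ (opnorm (cesaro_mean T n))).
    by apply: ereal_sup_ubound; exists x.
  by apply: ereal_sup_ubound; exists n.
move: hT op_bound; rewrite /cesaro_bounded.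
set S := ereal_sup _ => S_lty op_bound.
have S_ge0 : (0 <= S)%E.
  apply: le_trans (op_bound 1%N 0 _ _) => //; last by rewrite rnorm0.
  by rewrite lee_fin rnorm_ge0.
have S_fin : S \is a fin_num by rewrite ge0_fin_numE.
(* The added 1 keeps the constant positive even if the supremum is 0. *)
exists (fine S + 1) => [|n x n0].
  by rewrite ltr_pwDr// fine_ge0.
have [x0|x_gt0] := leP (rnorm x) 0.
  have -> : x = 0 by apply: rnorm0_eq0; apply/le_anti; rewrite x0 rnorm_ge0.
  rewrite rnorm0 mulr0 /cesaro_mean big1 ?scaler0 ?rnorm0// => k _.
  by elim: (k : nat) => //= m ->; rewrite linear0.
pose a := of_real s (rnorm x)^-1.
have ra : rnorm a = (rnorm x)^-1.
  apply: (can_inj (@of_realK R s)); rewrite of_real_rnorm ger0_norm//.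
  by rewrite -(of_real0 R s) ler_of_real invr_ge0 rnorm_ge0.
have meanZ : cesaro_mean T n (a *: x) = a *: cesaro_mean T n x.
  rewrite /cesaro_mean scalerA mulrC -scalerA; congr (_ *: _).
  rewrite scaler_sumr; apply: eq_bigr => k _.
  by elim: (k : nat) => //= m ->; rewrite linearZ.
have := op_bound n (a *: x) n0; rewrite meanZ !rnormZ ra mulVf ?gt_eqF//.
move=> /(_ (lexx _)); rewrite -(fineK S_fin) lee_fin.
rewrite ler_pdivrMl// => /le_trans; apply.
by rewrite mulrC ler_wpM2r ?rnorm_ge0// lerDl.
Qed.

(** * Iterates and means of the shift in coordinates *)

Lemma rnorm_lp_powR (R : realType) (s : scalars) (p : R) (hp : 1 <= p)
    (w : weight R) (x : lp s hp w) : (rnorm x `^ p)%:E = lp_sum p w x.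
Proof.
have p0 : p != 0 by rewrite gt_eqF// (lt_le_trans ltr01).
rewrite rnorm_lpE lp_norm.unlock -powRrM mulVf// powRr1.
  by rewrite fineK// lp_sum_fin.
by rewrite fine_ge0// lp_sum_ge0.
Qed.

Lemma lp_fun_iter_shift (R : realType) (s : scalars) (p : R) (hp : 1 <= p)
    (w : weight R) (hw : has_ubound (range (fun k => w k / w k.+1)))
    (n : nat) (x : lp s hp w) (j : nat) :
  lp_fun (iter n (backward_shift s hp hw) x) j = x (j + n)%N.
Proof.
elim: n j => [|n IH] j; first by rewrite addn0.
by rewrite iterS -[LHS]/(lp_fun (iter n _ x) j.+1) IH addSnnS.
Qed.

Lemma lp_fun_cesaro_shift (R : realType) (s : scalars) (p : R) (hp : 1 <= p)
    (w : weight R) (hw : has_ubound (range (fun k => w k / w k.+1)))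
    (n : nat) (x : lp s hp w) (j : nat) :
  lp_fun (cesaro_mean (backward_shift s hp hw) n x) j =
  n%:R^-1 * \sum_(i < n) x (j + i)%N.
Proof.
rewrite /cesaro_mean lp_funZ; congr (_ * _).
rewrite (big_morph (fun y : lp s hp w => lp_fun y j)
  (id1 := 0) (op1 := +%R) (id2 := 0) (op2 := +%R) (fun _ _ => erefl) erefl).
by apply: eq_bigr => i _; rewrite lp_fun_iter_shift.
Qed.

(** Substitution j = m - k. It lets a window sum be compared with a partial sum of an l^p series. *)
Lemma window_sum_rev (R : nmodType) (F : nat -> R) (m n : nat) :
  \sum_(k < n | (k <= m)%N) F (m - k)%N = \sum_(j < m.+1 | (m - j < n)%N) F j.
Proof.
rewrite -(big_mkord (fun k => k <= m)%N (fun k => F (m - k)%N)).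
rewrite -(big_mkord (fun j => m - j < n)%N F).
(* Both sums are widened to the common range below [n + m.+1], so that only their filters remain to
   be compared. *)
rewrite (big_nat_widen _ _ (n + m.+1)) ?leq_addr//.
rewrite [RHS]big_nat_rev/= add0n.
under [RHS]eq_bigl do rewrite subSS.
under [RHS]eq_bigr do rewrite subSS.
rewrite [RHS](big_nat_widen _ _ (n + m.+1)) ?leq_addl//.
apply: eq_bigl => k; rewrite ltnS andbC.
by case: (leqP k m) => [km|]; rewrite ?andbF// subKn.
Qed.

(** Tonelli for nonnegative terms: the entry [x m] survives [k] shifts exactly when [k <= m], and
    then carries the weight [w (m - k)]. *)
Lemma lp_sum_shift_sum (R : realType) (s : scalars) (p : R) (hp : 1 <= p)
    (w : weight R) (hw : has_ubound (range (fun k => w k / w k.+1)))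
    (n : nat) (x : lp s hp w) :
  ((\sum_(k < n) rnorm (iter k (backward_shift s hp hw) x) `^ p)%:E =
   \sum_(0 <= m <oo)
     (rnorm (x m) `^ p * \sum_(k < n | (k <= m)%N) w (m - k)%N `^ p)%:E)%E.
Proof.
(* The guard makes all series start at 0; for [k > m] truncated subtraction would otherwise
   contribute [w 0]. *)
pose f (k m : nat) : \bar R :=
  (rnorm (x m) `^ p * (if (k <= m)%N then w (m - k)%N `^ p else 0))%:E.
transitivity (\sum_(k < n) \sum_(0 <= m <oo) f k m)%E.
  rewrite -sumEFin; apply: eq_bigr => k _.
  rewrite rnorm_lp_powR lp_sum.unlock.
  transitivity (\sum_(k <= m <oo)
      (rnorm (x m) `^ p * w (m - k)%N `^ p)%:E)%E.
    rewrite -[RHS]nneseries_addn; last by move=> i; rewrite lee_fin mulr_ge0 ?powR_ge0.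
    by apply: eq_eseriesr => i _; rewrite lp_fun_iter_shift addnK.
  rewrite eseries_cond eseries_mkcond; apply: eq_eseriesr => m _.
  by rewrite /f /=; case: ifP => //; rewrite mulr0.
rewrite -nneseries_sum; last first.
  by move=> k m _; rewrite lee_fin mulr_ge0 ?powR_ge0//; case: ifP; rewrite ?powR_ge0.
apply: eq_eseriesr => m _.
by rewrite sumEFin -mulr_sumr -big_mkcond.
Qed.

Lemma lp_sum_indicator (R : realType) (s : scalars) (p : R) (hp : 1 <= p)
    (w : weight R) (m n : nat) :
  lp_sum p w (fun i => (m <= i < n)%:R : scalar_field R s) =
  (\sum_(m <= i < n) w i `^ p)%:E.
Proof.
have p0 : p != 0 by rewrite gt_eqF// (lt_le_trans ltr01).
rewrite lp_sum.unlock (nneseries_split 0 n)/=; last first.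
  by move=> k _; rewrite lee_fin mulr_ge0 ?powR_ge0.
rewrite add0n [X in (_ + X)%E]eseries0 ?adde0; last first.
  by move=> i ni _; rewrite ltnNge ni andbF rnorm0 powR0// mul0r.
rewrite sumEFin; congr (_%:E).
rewrite [RHS](big_nat_widenl _ 0%N)// big_mkcond/= !big_mkord.
rewrite [RHS]big_mkcond; apply: eq_bigr => i _ /=.
have r1 : rnorm (1 : scalar_field R s) = 1.
  by have := rnorm_natf_div R s 1 1; rewrite !invr1 !mulr1.
by rewrite ltn_ord andbT; case: ifP => _; rewrite ?r1 ?rnorm0 ?powR1 ?mul1r ?powR0 ?mul0r.
Qed.

(** Since [j <= m] and [i < n <= l], the upper end of the window is never reached, so the sum counts
    the [i] in [m - j, n). Truncated subtraction gives 0 when there are none. *)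
Lemma sum_indicator (K : pzRingType) (j m l n : nat) : (j <= m)%N -> (n <= l)%N ->
  \sum_(i < n) ((m <= j + i < m + l)%:R : K) = (n - (m - j))%:R.
Proof.
move=> jm nl; rewrite -natr_sum; congr (_%:R).
rewrite -(big_mkord xpredT (fun i => (m <= j + i < m + l)%N : nat)).
transitivity (\sum_(0 <= i < n | (m - j <= i)%N) 1)%N.
  rewrite [RHS]big_mkcond !big_mkord; apply: eq_bigr => i _.
  rewrite leq_subLR (leq_trans _ (_ : j + i < m + l)%N) ?andbT; last first.
  - by rewrite -addnS leq_add// (leq_trans (ltn_ord i)).
  - by [].
  by case: leqP.
have [h|h] := leqP n (m - j).
  rewrite big_nat_cond big_pred0 ?(eqP h)// => i.
  by case: (ltnP i n) => //= i_n; rewrite leqNgt (leq_trans i_n h).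
rewrite -(big_nat_widenl _ _ _ xpredT)//= sum_nat_const_nat muln1//.
Qed.

(** * The window estimate and the equivalence *)

Lemma cesaro_bounded_shift_window (R : realType) (s : scalars) (p : R)
    (hp : 1 <= p) (w : weight R)
    (hw : has_ubound (range (fun k => w k / w k.+1))) (D : R) :
  0 < D -> (forall m k, (m <= k)%N -> w k <= D * w m) ->
  cesaro_bounded (backward_shift s hp hw) ->
  exists2 C : R, 0 < C & forall m n,
    \sum_(k < n | (k <= m)%N) w (m - k)%N `^ p <= C * n%:R * w m `^ p.
Proof.
move=> D0 hD /cesaro_bounded_rnorm[C C0 hC].
have p0 : 0 < p by exact: lt_le_trans ltr01 hp.
(* The first factor undoes the lower bound 1/2 on the coordinates of the mean, C^p comes from Cesàro
   boundedness, and 2 D^p from the 2n entries of the test vector, each of weight at most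
   [D * w m]. *)
exists ((2^-1 `^ p)^-1 * (C `^ p * (2 * D `^ p))) => [|m n].
  by rewrite !mulr_gt0 ?invr_gt0 ?powR_gt0 ?invr_gt0.
have [->|n0] := posnP n; first by rewrite big_ord0 mulr0 mul0r.
rewrite -!mulrA ler_pdivlMl ?powR_gt0 ?invr_gt0//.
pose e i : scalar_field R s := (m <= i < m + 2 * n)%:R.
have e_lp : e \in lp_pred hp w.
  by apply/asboolP; rewrite lp_sum_indicator// ltry.
pose x := Lp e_lp.
have xle : rnorm x `^ p <= n%:R * 2 * (D `^ p * w m `^ p).
  rewrite -lee_fin rnorm_lp_powR lp_sum_indicator// lee_fin.
  apply: (@le_trans _ _ (\sum_(m <= i < m + 2 * n) D `^ p * w m `^ p)).
    rewrite !big_nat; apply: ler_sum => i /andP[mi _].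
    rewrite -powRM ?(ltW D0) ?(ltW (weight_gt0 _ _))//.
    apply: ge0_ler_powR; rewrite ?nnegrE ?(ltW p0) ?hD//.
      exact/ltW/weight_gt0.
    by rewrite mulr_ge0 ?(ltW D0)// ltW ?weight_gt0.
  by rewrite sumr_const_nat addKn -[leLHS]mulr_natl natrM (mulrC n%:R).
pose y := cesaro_mean (backward_shift s hp hw) (2 * n)%N x.
have yx : rnorm y `^ p <= C `^ p * rnorm x `^ p.
  rewrite -powRM ?(ltW C0) ?rnorm_ge0//.
  apply: ge0_ler_powR; rewrite ?nnegrE ?(ltW p0) ?mulr_ge0 ?rnorm_ge0 ?(ltW C0)//.
  by apply: hC; rewrite muln_gt0.
apply: (@le_trans _ _ (rnorm y `^ p)); last first.
  apply: le_trans yx _; rewrite ler_wpM2l ?powR_ge0//.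
  by apply: le_trans xle _; rewrite le_eqVlt; apply/orP; left; apply/eqP; ring.
rewrite (window_sum_rev _ (fun j => w j `^ p)) mulr_sumr.
rewrite -lee_fin rnorm_lp_powR lp_sum.unlock.
(* Only the coordinates of [y] up to [m] are kept. *)
apply: le_trans (nneseries_lim_ge m.+1 _); last first.
  by move=> k _ _; rewrite lee_fin mulr_ge0 ?powR_ge0.
rewrite sumEFin lee_fin big_mkord big_mkcond; apply: ler_sum => j _.
case: ifPn => [mj|_]; last by rewrite mulr_ge0 ?powR_ge0.
rewrite ler_wpM2r ?powR_ge0//.
apply: ge0_ler_powR; rewrite ?nnegrE ?(ltW p0) ?rnorm_ge0 ?invr_ge0//.
(* The coordinate equals (2n - (m - j)) / 2n, which is at least 1/2 because m - j < n. *)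
rewrite lp_fun_cesaro_shift sum_indicator//; last by rewrite -ltnS.
rewrite rnorm_natf_div mulrC ler_pdivlMr ?ltr0n ?muln_gt0//.
rewrite natrM mulrA mulVf// mul1r ler_nat.
by rewrite mul2n -addnn -addnBA ?leq_addr// ltnW.
Qed.

Theorem proposition3p7 (R : realType) (s : scalars) (p : R) (hp : 1 <= p)
    (w : weight R) (hw : has_ubound (range (fun k => w k / w k.+1)))
    (hmono : exists2 w' : weight R, nonincreasing_seq w' & equivalent_weights w w') :
  p_absolutely_cesaro_bounded p (backward_shift s hp hw) <->
  cesaro_bounded (backward_shift s hp hw).
Proof.
split; first exact: p_absolutely_cesaro_boundedW.
have [w' w'_mono [a [b [a0 ab ww']]]] := hmono.
have b0 : 0 < b by exact: lt_le_trans a0 ab.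
(* Chain a w_k <= w'_k <= w'_m <= b w_m. *)
have w_quasi_mono m k : (m <= k)%N -> w k <= b / a * w m.
  move=> mk; rewrite mulrAC ler_pdivlMr// mulrC.
  have /andP[awk _] := ww' k; have /andP[_ wbm] := ww' m.
  by rewrite (le_trans awk)// (le_trans (w'_mono _ _ mk)).
move=> /(cesaro_bounded_shift_window _ _ _ _ _ _ _ (divr_gt0 b0 a0)
  w_quasi_mono)[C C0 hC].
exists C => // x; apply: ge_ereal_sup => _ [n n0 <-].
rewrite EFinM lp_sum_shift_sum.
have n_gt0 : (0 : R) < n%:R by rewrite ltr0n.
(* Multiplying by [n] clears the average; the two series then compare term by term through the
   window estimate [hC]. *)
rewrite -(@lee_pmul2l _ n%:R%:E)// muleA -EFinM mulfV ?gt_eqF// mul1e.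
rewrite (EFinM C) rnorm_lp_powR muleA -EFinM lp_sum.unlock -nneseriesZl; last first.
  by move=> k _; rewrite lee_fin mulr_ge0 ?powR_ge0.
apply: lee_nneseries => m _.
  by move=> _; rewrite lee_fin mulr_ge0 ?powR_ge0// sumr_ge0// => k _; exact: powR_ge0.
by rewrite -EFinM lee_fin mulrCA ler_wpM2l ?powR_ge0// (mulrC n%:R).
Qed.
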